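(* (Non-abelian Stokes' Theorem for functors.) Let $X$ be a smooth manifold, let $G$ be a Lie group and let $F:\mathcal{P}_1(X)\to\mathcal{B}G$ be a functor, with derivative 2-functor $\mathrm{d}F:\mathcal{P}_2(X)\to\mathcal{B}\mathcal{E}G$. Then $$\mathrm{d}F(\Sigma)=F(\partial\Sigma)$$ for any bigon $\Sigma\in B^2X$.
   Context: **Paths and bigons.** A path $\gamma:x\to y$ is a smooth map $[0,1]\to X$ with, for some $0<\varepsilon<\frac12$, $\gamma(t)=x$ for $t<\varepsilon$ and $\gamma(t)=y$ for $t>1-\varepsilon$; $\gamma'\circ\gamma$ means first $\gamma$ then $\gamma'$; $\gamma^{-1}(t)=\gamma(1-t)$. A bigon $\Sigma:\gamma_0\Rightarrow\gamma_1$ between paths $\gamma_0,\gamma_1:x\to y$ is a smooth map $\Sigma:[0,1]^2\to X$ with, for some $0<\varepsilon<\frac12$, $\Sigma(s,t)=x$ for $t<\varepsilon$, $=y$ for $t>1-\varepsilon$, $=\gamma_0(t)$ for $s<\varepsilon$, $=\gamma_1(t)$ for $s>1-\varepsilon$. Two paths are thin homotopy equivalent if there is a bigon between them whose differential has rank $\le1$ everywhere; $P^1X$ is the set of classes. Bigons $\Sigma,\Sigma'$ are thin homotopy equivalent if there is a smooth $h:[0,1]^3\to X$ and $0<\varepsilon<\frac12$ with $h(r,s,t)=x$ for $t<\varepsilon$, $=y$ for $t>1-\varepsilon$; $h(r,s,t)=h(r,0,t)$ for $s<\varepsilon$ and $=h(r,1,t)$ for $s>1-\varepsilon$; $h(r,s,t)=\Sigma(s,t)$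 for $r<\varepsilon$ and $=\Sigma'(s,t)$ for $r>1-\varepsilon$; $\mathrm{rank}(\mathrm{d}h)\le2$ everywhere and $\mathrm{rank}(\mathrm{d}h|_{(r,i,t)})\le1$ for $i=0,1$. $B^2X$ is the set of classes. $\mathcal{P}_1(X)$ is the groupoid with objects $X$ and morphisms $P^1X$; $\mathcal{P}_2(X)$ is the strict 2-category with objects $X$, 1-morphisms $P^1X$, 2-morphisms $B^2X$, vertical composition being concatenation in $s$ and horizontal composition concatenation in $t$. **Targets.** $\mathcal{B}G$ is the groupoid with one object and morphisms $G$, $g_2\circ g_1=g_2g_1$. $\mathcal{E}G$ is the Lie 2-group of the crossed module $(G,G,\mathrm{id},\alpha)$ with $\alpha(g,h)=ghg^{-1}$; the 2-groupoid $\mathcal{B}\mathcal{E}G$ has one object, 1-morphisms $g\in G$ with $g_2\circ g_1=g_2g_1$, and between any two 1-morphisms $g,g'$ exactly one 2-morphism $g\Rightarrow g'$, which is labelled by (and identified with) the group element $h=g'g^{-1}$. **Derivative 2-functor.** $\mathrm{d}F:\mathcal{P}_2(X)\to\mathcal{B}\mathcal{E}G$ is the unique 2-functor with $\mathrm{d}F(\gamma)=F(\gamma)$ for $\gamma\in P^1X$; $\mathrm{d}F(\Sigma)\in G$ denotes the group element labelling the 2-morphism assigned to $\Sigma$. For a bigon $\Sigma:\gamma_1\Rightarrow\gamma_2$, $\partial\Sigma$ denotes the 1-morphism $\gamma_2\circ\gamma_1^{-1}$. *)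

(* Defs.v *)
From HB Require Import structures.
From mathcomp Require Import all_boot all_order all_algebra.
From mathcomp Require Import all_classical all_reals all_analysis.
From mathcomp Require Import lra.

Set Implicit Arguments.
Unset Strict Implicit.
Unset Printing Implicit Defensive.

Import Order.TTheory GRing.Theory Num.Theory.
Import numFieldNormedType.Exports.

Local Open Scope classical_set_scope.
Local Open Scope ring_scope.

(* [Ck k U f] is meant for open [U] in a finite-dimensional space: [f] is C^(k+1)
   on [U] iff it is differentiable there and all its directional derivatives
   are C^k on [U]. *)
Fixpoint Ck (R : realType) (V W : normedModType R) (k : nat) (U : set V)
    (f : V -> W) : Prop :=
  match k with
  | 0 => forall p, U p -> {for p, continuous f}
  | k'.+1 => (forall p, U p -> differentiable f p) /\
             (forall v : V, Ck k' U ('D_v f))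
  end.

Definition Cinfty (R : realType) (V W : normedModType R) (U : set V)
    (f : V -> W) : Prop := forall k, Ck k U f.

(* Both [chart_fun] and [chart_inv] are total functions; only their values on
   [chart_dom] and [chart_cod] matter. *)
Record chart (R : realType) (n : nat) (X : topologicalType) := Chart {
  chart_dom : set X;
  chart_cod : set 'rV[R]_n;
  chart_fun :> X -> 'rV[R]_n;
  chart_inv : 'rV[R]_n -> X;
  chart_dom_open : open chart_dom;
  chart_cod_open : open chart_cod;
  chart_funP : forall x, chart_dom x -> chart_cod (chart_fun x);
  chart_invP : forall p, chart_cod p -> chart_dom (chart_inv p);
  chart_funK : forall x, chart_dom x -> chart_inv (chart_fun x) = x;
  chart_invK : forall p, chart_cod p -> chart_fun (chart_inv p) = p;
  chart_fun_continuous :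
    forall x, chart_dom x -> {for x, continuous chart_fun};
  chart_inv_continuous :
    forall p, chart_cod p -> {for p, continuous chart_inv} }.

Definition smooth_compatible (R : realType) (n : nat) (X : topologicalType)
    (c d : chart R n X) : Prop :=
  Cinfty (chart_cod c `&` chart_inv c @^-1` chart_dom d)
         (fun p => d (chart_inv c p)).

HB.mixin Record isSmoothManifold (R : realType) (n : nat) X
    of Topological X := {
  atlas : set (chart R n X);
  atlas_cover : forall x : X, exists2 c, atlas c & chart_dom c x;
  atlas_compatible : forall c d, atlas c -> atlas d -> smooth_compatible c d;
  manifold_hausdorff : hausdorff_space X;
  manifold_second_countable : @second_countable X }.

#[short(type="smoothManifoldType")]
HB.structure Definition SmoothManifold (R : realType) (n : nat) :=
  { X of Topological X & isSmoothManifold R n X }.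

Definition smooth_map (R : realType) (m n : nat) (X : smoothManifoldType R m)
    (Y : smoothManifoldType R n) (f : X -> Y) : Prop :=
  forall x, exists c d U,
    [/\ atlas c, atlas d,
        chart_dom c x & [/\ open U, U (c x),
        U `<=` chart_cod c `&` [set p | chart_dom d (f (chart_inv c p))]
      & Cinfty U (fun p => d (f (chart_inv c p)))]].

Definition smooth_map2 (R : realType) (l m n : nat)
    (X : smoothManifoldType R l) (Y : smoothManifoldType R m)
    (Z : smoothManifoldType R n) (f : X -> Y -> Z) : Prop :=
  forall x y, exists (b : chart R l X) (c : chart R m Y) (d : chart R n Z)
      (U : set ('rV[R]_l * 'rV[R]_m)),
    [/\ atlas b, atlas c, atlas d & [/\ chart_dom b x, chart_dom c y,
        open U, U (b x, c y)
      & (forall p, U p -> [/\ chart_cod b p.1, chart_cod c p.2 &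
            chart_dom d (f (chart_inv b p.1) (chart_inv c p.2))]) /\
        Cinfty U (fun p => d (f (chart_inv b p.1) (chart_inv c p.2)))]].

HB.mixin Record isLieGroup (R : realType) (n : nat) G
    of SmoothManifold R n G & Group G := {
  lie_mul_smooth : smooth_map2 (fun g h : G => (g * h)%g);
  lie_inv_smooth : smooth_map (fun g : G => (g^-1)%g) }.

#[short(type="lieGroupType")]
HB.structure Definition LieGroup (R : realType) (n : nat) :=
  { G of SmoothManifold R n G & Group G & isLieGroup R n G }.

Definition cube (R : realType) (k : nat) : set 'rV[R]_k :=
  [set p | forall i, 0 <= p 0 i <= 1].

(* Near the point [p] of the closed cube, [g] is a smooth map on an open subset
   of R^k extending the coordinate expression of [f] in the chart [c]. *)
Definition local_rep (R : realType) (k n : nat) (X : smoothManifoldType R n)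
    (f : 'rV[R]_k -> X) (p : 'rV[R]_k) (c : chart R n X)
    (g : 'rV[R]_k -> 'rV[R]_n) : Prop :=
  atlas c /\ exists U : set 'rV[R]_k,
    [/\ open U, U p,
        (forall q, U q -> cube q -> chart_dom c (f q) /\ c (f q) = g q)
      & Cinfty U g].

Definition cube_smooth (R : realType) (k n : nat) (X : smoothManifoldType R n)
    (f : 'rV[R]_k -> X) : Prop :=
  forall p, cube p -> exists c g, local_rep f p c g.

(* At a boundary point of the cube the Jacobian does not depend on the chosen
   extension [g], the cube being the closure of its interior. *)
Definition drank_le (R : realType) (k n : nat) (X : smoothManifoldType R n)
    (f : 'rV[R]_k -> X) (p : 'rV[R]_k) (r : nat) : Prop :=
  exists c g, local_rep f p c g /\ (\rank ('J g p) <= r)%N.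

Definition on_cube1 (R : realType) (X : Type) (f : R -> X) (p : 'rV[R]_1) : X :=
  f (p 0 0).
Definition on_cube2 (R : realType) (X : Type) (f : R -> R -> X)
    (p : 'rV[R]_2) : X :=
  f (p 0 0) (p 0 1).
Definition on_cube3 (R : realType) (X : Type) (f : R -> R -> R -> X)
    (p : 'rV[R]_3) : X :=
  f (p 0 0) (p 0 1) (p 0 2).

(* A map on [0,1]^k is encoded by a total function of which only the values on
   [0,1]^k are constrained; functions agreeing on [0,1]^k become equal in the
   quotients [P1] and [B2]. *)
Definition path_sitting (R : realType) (X : Type) (x y : X) (f : R -> X) :=
  exists2 e : R, 0 < e < 1 / 2 & forall t : R, 0 <= t <= 1 ->
    (t < e -> f t = x) /\ (1 - e < t -> f t = y).

Record smooth_path (R : realType) (n : nat) (X : smoothManifoldType R n)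
    (x y : X) := SmoothPath {
  path_fun :> R -> X;
  path_smooth : cube_smooth (on_cube1 path_fun);
  path_sit : path_sitting x y path_fun }.

Definition bigon_sitting (R : realType) (X : Type) (x y : X) (f0 f1 : R -> X)
    (S : R -> R -> X) :=
  exists2 e : R, 0 < e < 1 / 2 & forall s t : R, 0 <= s <= 1 -> 0 <= t <= 1 ->
    [/\ t < e -> S s t = x, 1 - e < t -> S s t = y,
        s < e -> S s t = f0 t & 1 - e < s -> S s t = f1 t].

Record bigon (R : realType) (n : nat) (X : smoothManifoldType R n)
    (x y : X) (g0 g1 : smooth_path x y) := Bigon {
  bigon_fun :> R -> R -> X;
  bigon_smooth : cube_smooth (on_cube2 bigon_fun);
  bigon_sit : bigon_sitting x y g0 g1 bigon_fun }.

Definition thin_path (R : realType) (n : nat) (X : smoothManifoldType R n)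
    (x y : X) (g0 g1 : smooth_path x y) : Prop :=
  exists S : bigon g0 g1, forall p, cube p -> drank_le (on_cube2 S) p 1.

Definition thin_bigon (R : realType) (n : nat) (X : smoothManifoldType R n)
    (x y : X) (g0 g1 g0' g1' : smooth_path x y)
    (S : bigon g0 g1) (S' : bigon g0' g1') : Prop :=
  exists h : R -> R -> R -> X,
    [/\ cube_smooth (on_cube3 h),
        exists2 e : R, 0 < e < 1 / 2 & forall r s t : R,
          0 <= r <= 1 -> 0 <= s <= 1 -> 0 <= t <= 1 ->
          [/\ (t < e -> h r s t = x) /\ (1 - e < t -> h r s t = y),
              s < e -> h r s t = h r 0 t, 1 - e < s -> h r s t = h r 1 t,
              r < e -> h r s t = S s t & 1 - e < r -> h r s t = S' s t],
        forall p, cube p -> drank_le (on_cube3 h) p 2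
      & forall p, cube p -> p 0 1 = 0 \/ p 0 1 = 1 ->
          drank_le (on_cube3 h) p 1].

Record P1 (R : realType) (n : nat) (X : smoothManifoldType R n) (x y : X) :=
  MkP1 {
  P1_class : set (smooth_path x y);
  P1_classP : exists g, P1_class = thin_path g }.

Definition p1 (R : realType) (n : nat) (X : smoothManifoldType R n) (x y : X)
    (g : smooth_path x y) : P1 x y :=
  MkP1 (ex_intro _ g erefl).

Record any_bigon (R : realType) (n : nat) (X : smoothManifoldType R n)
    (x y : X) := AnyBigon {
  bsrc : smooth_path x y;
  btgt : smooth_path x y;
  bbigon :> bigon bsrc btgt }.

(* The 2-morphisms [a => b] of the path 2-groupoid. *)
Record B2 (R : realType) (n : nat) (X : smoothManifoldType R n) (x y : X)
    (a b : P1 x y) := MkB2 {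
  B2_class : set (any_bigon x y);
  B2_classP : exists S : any_bigon x y,
    [/\ p1 (bsrc S) = a, p1 (btgt S) = b
      & B2_class = [set S' : any_bigon x y | thin_bigon S S']] }.

Definition b2 (R : realType) (n : nat) (X : smoothManifoldType R n) (x y : X)
    (g0 g1 : smooth_path x y) (S : bigon g0 g1) : B2 (p1 g0) (p1 g1) :=
  MkB2 (ex_intro _ (AnyBigon S) (And3 erefl erefl erefl)).


Section precomposition.
Context {R : realType}.

Lemma Ck_affine (V V' W : normedModType R) (A L : V -> V') (g : V' -> W) k U :
  (forall p, differentiable A p) ->
  (forall (h : R) v p, A (h *: v + p) = h *: L v + A p) ->
  Ck k U g -> Ck k (A @^-1` U) (g \o A).
Proof.
move=> dA aff; elim: k g => [|k IH] g /=.
  move=> gc p Up; apply: continuous_comp; last exact: gc.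
  exact: differentiable_continuous.
move=> [gd gD]; split=> [p Up|v].
  by apply: differentiable_comp => //; exact: gd.
suff -> : 'D_v (g \o A) = ('D_(L v) g) \o A by exact: IH.
apply/funext => p; rewrite [RHS]/= /derive.
suff -> : (fun h : R => h^-1 *: ((g \o A \o shift p) (h *: v) - (g \o A) p)) =
  (fun h : R => h^-1 *: ((g \o shift (A p)) (h *: L v) - g (A p))) by [].
by apply/funext => h; rewrite /= aff.
Qed.

Lemma Ck_subset (V W : normedModType R) (g : V -> W) k (U U' : set V) :
  U' `<=` U -> Ck k U g -> Ck k U' g.
Proof.
move=> sU; elim: k g => [|k IH] g /=; first by move=> gc p /sU /gc.
by move=> [gd gD]; split=> [p /sU /gd //|v]; exact/IH/gD.
Qed.

Lemma Ck_cst (V W : normedModType R) (a : W) k (U : set V) : Ck k U (cst a).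
Proof.
elim: k a => [|k IH] a /=; first by move=> p _; exact: cst_continuous.
split=> [p _|v]; first exact: differentiable_cst.
suff -> : 'D_v (cst a) = cst 0 :> (V -> W) by exact: IH.
by apply/funext => p; exact: derive_cst.
Qed.

Definition aff (l k : nat) (s : 'I_k -> 'I_l) (u b : 'I_k -> R)
    (q : 'rV[R]_l) : 'rV[R]_k :=
  \row_j (u j * q 0 (s j) + b j).

Lemma aff_differentiable l k s u b p : differentiable (@aff l k s u b) p.
Proof.
have -> : aff s u b = \sum_j (fun q : 'rV[R]_l =>
    (u j * q 0 (s j)) *: (delta_mx 0 j : 'rV[R]_k)) + cst (\row_j b j).
  apply/funext => q; apply/rowP => j; rewrite mxE fctE fct_sumE mxE summxE.
  rewrite (bigD1 j) //= big1 ?addr0 => [|i ij]; rewrite !mxE eqxx/=.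
    by rewrite eqxx mulr1.
  by rewrite eq_sym (negbTE ij) mulr0.
apply: differentiableD; last exact: differentiable_cst.
apply: differentiable_sum => j; apply: differentiableZl.
by apply: (@differentiableZ _ _ _ _ (u j)); exact: differentiable_coord.
Qed.

Lemma aff_affine l k s u b (h : R) v p :
  @aff l k s u b (h *: v + p) = h *: aff s u (fun=> 0) v + aff s u b p.
Proof. by apply/rowP => j; rewrite !mxE addr0 mulrDr mulrCA addrA. Qed.

Context {n : nat} {X : smoothManifoldType R n}.

Lemma jacobian_aff_rank l k s u b (g : 'rV[R]_k -> 'rV[R]_n) p :
  differentiable g (@aff l k s u b p) ->
  (\rank ('J (g \o aff s u b) p) <= \rank ('J g (aff s u b p)))%N.
Proof.
move=> dg; apply/mxrankS/rV_subP => v /submxP[w ->].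
have dA := @aff_differentiable l k s u b p.
rewrite -deriveEjacobian; last exact: differentiable_comp.
rewrite (deriveE _ (differentiable_comp dA dg)) diff_comp //=.
by rewrite -deriveE // deriveEjacobian // submxMl.
Qed.

Lemma drank_aff l k s u b (f : 'rV[R]_k -> X) (f' : 'rV[R]_l -> X) p r :
  (forall q, cube q -> drank_le f q r) -> cube p ->
  (\forall q \near nbhs p, cube q ->
     cube (aff s u b q) /\ f' q = f (aff s u b q)) ->
  drank_le f' p r.
Proof.
move=> fs cp; rewrite /prop_near1 nbhsE => -[W [oW Wp] sW].
have [cAp _] := sW _ Wp cp.
have [c [g [[ac [U [oU Up Uf gs]]] gr]]] := fs _ cAp.
exists c, (g \o aff s u b); split; last first.
  by apply: leq_trans gr; apply: jacobian_aff_rank; exact: (proj1 (gs 1)).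
split=> //; exists (W `&` aff s u b @^-1` U); split.
- apply: openI => //; apply: open_comp => // q _.
  exact/differentiable_continuous/aff_differentiable.
- by split.
- by move=> q [Wq Uq] cq; have [cAq ->] := sW _ Wq cq; exact: Uf.
- move=> m; apply: (@Ck_subset _ _ _ _ (aff s u b @^-1` U)); first by move=> ? [].
  by apply: Ck_affine (gs m); [exact: aff_differentiable|exact: aff_affine].
Qed.

Lemma drank_cst l (f' : 'rV[R]_l -> X) p y r :
  (\forall q \near nbhs p, cube q -> f' q = y) ->
  drank_le f' p r.
Proof.
rewrite /prop_near1 nbhsE => -[W [oW Wp] sW].
have [c ac cy] := atlas_cover y.
exists c, (cst (c y)); split; last first.
  rewrite (_ : 'J _ _ = 0) ?mxrank0 //; apply/row_matrixP => i.
  by rewrite rowE -deriveEjacobian ?derive_cst ?row0 //; exact: differentiable_cst.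
split=> //; exists W; split=> //.
  by move=> q Wq cq; rewrite (sW _ Wq cq).
by move=> m; exact: Ck_cst.
Qed.

Lemma cube_smoothP k (f : 'rV[R]_k -> X) :
  cube_smooth f <-> forall p, cube p -> drank_le f p n.
Proof.
split=> fs p /fs[c [g]].
  by move=> fg; exists c, g; split=> //; exact: rank_leq_col.
by case=> fg _; exists c, g.
Qed.

Lemma drank_path (f : 'rV[R]_1 -> X) p :
  cube_smooth f -> cube p -> drank_le f p 1.
Proof. by move=> fs /fs[c [g fg]]; exists c, g; split=> //; exact: rank_leq_row. Qed.

Lemma near_coord_lt l (p : 'rV[R]_l) i a :
  p 0 i < a -> \forall q \near nbhs p, (q : 'rV[R]_l) 0 i < a.
Proof. by move=> pa; exact: (@coord_continuous R 1 l 0 i p _ (lt_nbhsl pa)). Qed.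

Lemma near_coord_gt l (p : 'rV[R]_l) i a :
  a < p 0 i -> \forall q \near nbhs p, a < (q : 'rV[R]_l) 0 i.
Proof. by move=> pa; exact: (@coord_continuous R 1 l 0 i p _ (lt_nbhsr pa)). Qed.


End precomposition.

Section concatenation.
Context {R : realType} {n : nat} {X : smoothManifoldType R n}.
Implicit Types (x y z : X).

Lemma const_smooth x : cube_smooth (on_cube1 (fun _ : R => x)).
Proof. by apply/cube_smoothP => p _; apply: (@drank_cst _ _ _ _ _ _ x); exact: nearW. Qed.

Lemma const_sit x : path_sitting x x (fun _ : R => x).
Proof. by exists (1 / 4) => //; lra. Qed.

Definition path_id x : smooth_path x x :=
  SmoothPath (const_smooth x) (const_sit x).

Definition inv_fun (f : R -> X) (t : R) : X := f (1 - t).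

Lemma inv_smooth x y (g : smooth_path x y) :
  cube_smooth (on_cube1 (inv_fun g)).
Proof.
apply/cube_smoothP => p cp.
apply: (@drank_aff _ _ _ _ _ (fun=> 0) (fun=> -1) (fun=> 1)
  (on_cube1 g)) => //; first exact/cube_smoothP/path_smooth.
apply: nearW => q cq; have := cq 0 => q0; split=> [i|]; rewrite /on_cube1 ?mxE.
  by lra.
by rewrite /inv_fun; congr path_fun; lra.
Qed.

Lemma inv_sit x y (g : smooth_path x y) : path_sitting y x (inv_fun g).
Proof.
have [e e0 H] := path_sit g; exists e => // t t01.
have [|Hx Hy] := H (1 - t); first by lra.
by split=> ht; [apply: Hy|apply: Hx]; lra.
Qed.

Definition path_inv x y (g : smooth_path x y) : smooth_path y x :=
  SmoothPath (inv_smooth g) (inv_sit g).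

Definition cat_fun (f' f : R -> X) (t : R) : X :=
  if t <= 1 / 2 then f (2 * t) else f' (2 * t - 1).

Lemma cat_smooth x y z (g' : smooth_path y z) (g : smooth_path x y) :
  cube_smooth (on_cube1 (cat_fun g' g)).
Proof.
apply/cube_smoothP => p cp.
have [t12|t12|t12] := ltgtP (p 0 0) (1 / 2).
- apply: (@drank_aff _ _ _ _ _ (fun=> 0) (fun=> 2) (fun=> 0)
    (on_cube1 g)) => //; first exact/cube_smoothP/path_smooth.
  near=> q => cq; have q0 := cq 0.
  have t0 : q 0 0 < 1 / 2 by near: q; exact: near_coord_lt.
  split=> [i|]; rewrite /on_cube1 ?mxE; first by lra.
  by rewrite /cat_fun ltW // addr0.
- apply: (@drank_aff _ _ _ _ _ (fun=> 0) (fun=> 2) (fun=> -1)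
    (on_cube1 g')) => //; first exact/cube_smoothP/path_smooth.
  near=> q => cq; have q0 := cq 0.
  have t0 : 1 / 2 < q 0 0 by near: q; exact: near_coord_gt.
  split=> [i|]; rewrite /on_cube1 ?mxE; first by lra.
  by rewrite /cat_fun leNgt t0.
- have [e e0 H] := path_sit g; have [e' e'0 H'] := path_sit g'.
  apply: (@drank_cst _ _ _ _ _ _ y).
  near=> q => cq; have q0 := cq 0; rewrite /on_cube1 /cat_fun.
  have tl : q 0 0 < 1 / 2 + e' / 2.
    by near: q; apply: near_coord_lt; rewrite t12; lra.
  have tg : 1 / 2 - e / 2 < q 0 0.
    by near: q; apply: near_coord_gt; rewrite t12; lra.
  by case: ifPn => [t0|]; [apply: (proj2 (H _ _))|rewrite -ltNge => t0;
    apply: (proj1 (H' _ _))]; lra.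
Unshelve. all: by end_near. Qed.

Lemma cat_sit x y z (g' : smooth_path y z) (g : smooth_path x y) :
  path_sitting x z (cat_fun g' g).
Proof.
have [e e0 H] := path_sit g; have [e' e'0 H'] := path_sit g'.
exists (Num.min e e' / 2) => [|t t01].
  by case: (ltP e e') => ee'; lra.
have me : Num.min e e' <= e by rewrite ge_min lexx.
have me' : Num.min e e' <= e' by rewrite ge_min lexx orbT.
rewrite /cat_fun; split=> ht.
  by rewrite ifT; [apply: (proj1 (H _ _))|]; lra.
by rewrite leNgt ifF; [apply: (proj2 (H' _ _)); lra|apply/negbF; lra].
Qed.

(* First [g], then [g']. *)
Definition path_comp x y z (g' : smooth_path y z) (g : smooth_path x y) :
    smooth_path x z :=
  SmoothPath (cat_smooth g' g) (cat_sit g' g).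

Lemma ord2_ind (P : 'I_2 -> Prop) : P 0 -> P 1 -> forall i, P i.
Proof.
by move=> P0 P1 [[|[|//]] i]; [rewrite (_ : Ordinal i = 0)|
  rewrite (_ : Ordinal i = 1)] => //; exact: val_inj.
Qed.

Definition pair2 (T : Type) (a b : T) (i : 'I_2) : T := if i == 0 then a else b.

Lemma bigon_id_rank x y (g : smooth_path x y) r p :
  (forall q, cube q -> drank_le (on_cube1 g) q r) -> cube p ->
  drank_le (on_cube2 (fun _ : R => g : R -> X)) p r.
Proof.
move=> gr cp; apply: (@drank_aff _ _ _ _ _ (fun=> 1) (fun=> 1) (fun=> 0)
  (on_cube1 g)) => //.
apply: nearW => q cq; have q0 := cq 1.
by split=> [i|]; rewrite /on_cube1 /on_cube2 !mxE mul1r addr0.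
Qed.

Lemma bigon_id_smooth x y (g : smooth_path x y) :
  cube_smooth (on_cube2 (fun _ : R => g : R -> X)).
Proof.
apply/cube_smoothP => p; apply: bigon_id_rank.
exact/cube_smoothP/path_smooth.
Qed.

Lemma bigon_id_sit x y (g : smooth_path x y) :
  bigon_sitting x y g g (fun _ : R => g : R -> X).
Proof.
have [e e0 H] := path_sit g; exists e => // s t _ t01.
by have [Hx Hy] := H t t01.
Qed.

Definition bigon_id x y (g : smooth_path x y) : bigon g g :=
  Bigon (bigon_id_smooth g) (bigon_id_sit g).

(* The bigon run backwards in [s]. *)
Definition srev_fun (S : R -> R -> X) (s t : R) : X := S (1 - s) t.

Lemma srev_rank (S : R -> R -> X) r p :
  (forall q, cube q -> drank_le (on_cube2 S) q r) -> cube p ->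
  drank_le (on_cube2 (srev_fun S)) p r.
Proof.
move=> Sr cp; apply: (@drank_aff _ _ _ _ _ id (pair2 (-1) 1) (pair2 1 0)
  (on_cube2 S)) => //.
apply: nearW => q cq; have q0 := cq 0; have q1 := cq 1; split=> [i|].
  by move: i; apply: ord2_ind; rewrite mxE /pair2 /=; lra.
by rewrite /on_cube2 !mxE /= /srev_fun addr0 mul1r mulN1r addrC.
Qed.

Lemma srev_smooth x y (g0 g1 : smooth_path x y) (S : bigon g0 g1) :
  cube_smooth (on_cube2 (srev_fun S)).
Proof.
apply/cube_smoothP => p; apply: srev_rank.
exact/cube_smoothP/bigon_smooth.
Qed.

Lemma srev_sit x y (g0 g1 : smooth_path x y) (S : bigon g0 g1) :
  bigon_sitting x y g1 g0 (srev_fun S).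
Proof.
have [e e0 H] := bigon_sit S; exists e => // s t s01 t01.
have [||Hx Hy H0 H1] := H (1 - s) t; [lra|by []|].
by split=> h; [apply: Hx|apply: Hy|apply: H1|apply: H0]; lra.
Qed.

Definition srev x y (g0 g1 : smooth_path x y) (S : bigon g0 g1) : bigon g1 g0 :=
  Bigon (srev_smooth S) (srev_sit S).

(* The bigon run backwards in [t]. *)
Definition trev_fun (S : R -> R -> X) (s t : R) : X := S s (1 - t).

Lemma trev_rank (S : R -> R -> X) r p :
  (forall q, cube q -> drank_le (on_cube2 S) q r) -> cube p ->
  drank_le (on_cube2 (trev_fun S)) p r.
Proof.
move=> Sr cp; apply: (@drank_aff _ _ _ _ _ id (pair2 1 (-1)) (pair2 0 1)
  (on_cube2 S)) => //.
apply: nearW => q cq; have q0 := cq 0; have q1 := cq 1; split=> [i|].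
  by move: i; apply: ord2_ind; rewrite mxE /pair2 /=; lra.
by rewrite /on_cube2 !mxE /= /trev_fun addr0 mul1r mulN1r addrC.
Qed.

Lemma trev_smooth x y (g0 g1 : smooth_path x y) (S : bigon g0 g1) :
  cube_smooth (on_cube2 (trev_fun S)).
Proof.
apply/cube_smoothP => p; apply: trev_rank.
exact/cube_smoothP/bigon_smooth.
Qed.

Lemma trev_sit x y (g0 g1 : smooth_path x y) (S : bigon g0 g1) :
  bigon_sitting y x (path_inv g0) (path_inv g1) (trev_fun S).
Proof.
have [e e0 H] := bigon_sit S; exists e => // s t s01 t01.
have [||Hx Hy H0 H1] := H s (1 - t); [by []|lra|].
by split=> h; [apply: Hy|apply: Hx|apply: H0|apply: H1]; lra.
Qed.

Definition trev x y (g0 g1 : smooth_path x y) (S : bigon g0 g1) :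
    bigon (path_inv g0) (path_inv g1) :=
  Bigon (trev_smooth S) (trev_sit S).

Definition vcat_fun (S' S : R -> R -> X) (s t : R) : X :=
  if s <= 1 / 2 then S (2 * s) t else S' (2 * s - 1) t.

Lemma vcat_rank x y (g0 g1 g2 : smooth_path x y)
    (S' : bigon g1 g2) (S : bigon g0 g1) r p :
  (forall q, cube q -> drank_le (on_cube2 S') q r) ->
  (forall q, cube q -> drank_le (on_cube2 S) q r) -> cube p ->
  drank_le (on_cube2 (vcat_fun S' S)) p r.
Proof.
move=> Sr' Sr cp.
have [s12|s12|s12] := ltgtP (p 0 0) (1 / 2).
- apply: (@drank_aff _ _ _ _ _ id (pair2 2 1) (fun=> 0) (on_cube2 S)) => //.
  near=> q => cq; have q0 := cq 0; have q1 := cq 1.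
  have s0 : q 0 0 < 1 / 2 by near: q; exact: near_coord_lt.
  split=> [i|]; last by rewrite /on_cube2 !mxE /= /vcat_fun ltW // !addr0 mul1r.
  by move: i; apply: ord2_ind; rewrite mxE /pair2 /=; lra.
- apply: (@drank_aff _ _ _ _ _ id (pair2 2 1) (pair2 (-1) 0)
    (on_cube2 S')) => //.
  near=> q => cq; have q0 := cq 0; have q1 := cq 1.
  have s0 : 1 / 2 < q 0 0 by near: q; exact: near_coord_gt.
  split=> [i|]; first by move: i; apply: ord2_ind; rewrite mxE /pair2 /=; lra.
  by rewrite /on_cube2 !mxE /= /vcat_fun leNgt s0 addr0 mul1r.
- have [e e0 H] := bigon_sit S; have [e' e'0 H'] := bigon_sit S'.
  apply: (@drank_aff _ _ _ _ _ id (pair2 0 1) (pair2 1 0) (on_cube2 S)) => //.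
  near=> q => cq; have q0 := cq 0; have q1 := cq 1.
  have sl : q 0 0 < 1 / 2 + e' / 2.
    by near: q; apply: near_coord_lt; rewrite s12; lra.
  have sg : 1 / 2 - e / 2 < q 0 0.
    by near: q; apply: near_coord_gt; rewrite s12; lra.
  split=> [i|]; first by move: i; apply: ord2_ind; rewrite mxE /pair2 /=; lra.
  rewrite /on_cube2 !mxE /= mul0r add0r addr0 mul1r.
  have -> : S 1 (q 0 1) = g1 (q 0 1).
    by have [||_ _ _ Hm] := H 1 (q 0 1); [lra|lra|apply: Hm; lra].
  rewrite /vcat_fun; case: ifPn => [s0|]; last rewrite -ltNge => s0.
    by have [||_ _ _ Hm] := H (2 * q 0 0) (q 0 1); [lra|lra|apply: Hm; lra].
  by have [||_ _ Hm _] := H' (2 * q 0 0 - 1) (q 0 1);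
    [lra|lra|apply: Hm; lra].
Unshelve. all: by end_near. Qed.

Lemma vcat_smooth x y (g0 g1 g2 : smooth_path x y)
    (S' : bigon g1 g2) (S : bigon g0 g1) :
  cube_smooth (on_cube2 (vcat_fun S' S)).
Proof.
by apply/cube_smoothP => p; apply: vcat_rank; exact/cube_smoothP/bigon_smooth.
Qed.

Lemma vcat_sit x y (g0 g1 g2 : smooth_path x y)
    (S' : bigon g1 g2) (S : bigon g0 g1) :
  bigon_sitting x y g0 g2 (vcat_fun S' S).
Proof.
have [e e0 H] := bigon_sit S; have [e' e'0 H'] := bigon_sit S'.
exists (Num.min e e' / 2) => [|s t s01 t01].
  by case: (ltP e e') => ee'; lra.
have me : Num.min e e' <= e by rewrite ge_min lexx.
have me' : Num.min e e' <= e' by rewrite ge_min lexx orbT.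
have m0 : 0 < Num.min e e' by case: (ltP e e') => ee'; lra.
rewrite /vcat_fun; case: ifPn => [s0|]; last rewrite -ltNge => s0.
  have [||Hx Hy H0 H1] := H (2 * s) t; [lra|by []|].
  by split=> h; [apply: Hx|apply: Hy|apply: H0|exfalso]; lra.
have [||Hx Hy H0 H1] := H' (2 * s - 1) t; [lra|by []|].
by split=> h; [apply: Hx|apply: Hy|exfalso|apply: H1]; lra.
Qed.

(* Vertical composition: first [S], then [S']. *)
Definition vcomp x y (g0 g1 g2 : smooth_path x y)
    (S' : bigon g1 g2) (S : bigon g0 g1) : bigon g0 g2 :=
  Bigon (vcat_smooth S' S) (vcat_sit S' S).

Definition hcat_fun (S' S : R -> R -> X) (s t : R) : X :=
  if t <= 1 / 2 then S s (2 * t) else S' s (2 * t - 1).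

Lemma hcat_rank x y z (g0 g1 : smooth_path x y) (g0' g1' : smooth_path y z)
    (S' : bigon g0' g1') (S : bigon g0 g1) r p :
  (forall q, cube q -> drank_le (on_cube2 S') q r) ->
  (forall q, cube q -> drank_le (on_cube2 S) q r) -> cube p ->
  drank_le (on_cube2 (hcat_fun S' S)) p r.
Proof.
move=> Sr' Sr cp.
have [t12|t12|t12] := ltgtP (p 0 1) (1 / 2).
- apply: (@drank_aff _ _ _ _ _ id (pair2 1 2) (fun=> 0) (on_cube2 S)) => //.
  near=> q => cq; have q0 := cq 0; have q1 := cq 1.
  have t0 : q 0 1 < 1 / 2 by near: q; exact: near_coord_lt.
  split=> [i|]; last by rewrite /on_cube2 !mxE /= /hcat_fun ltW // !addr0 mul1r.
  by move: i; apply: ord2_ind; rewrite mxE /pair2 /=; lra.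
- apply: (@drank_aff _ _ _ _ _ id (pair2 1 2) (pair2 0 (-1))
    (on_cube2 S')) => //.
  near=> q => cq; have q0 := cq 0; have q1 := cq 1.
  have t0 : 1 / 2 < q 0 1 by near: q; exact: near_coord_gt.
  split=> [i|]; first by move: i; apply: ord2_ind; rewrite mxE /pair2 /=; lra.
  by rewrite /on_cube2 !mxE /= /hcat_fun leNgt t0 addr0 mul1r.
- have [e e0 H] := bigon_sit S; have [e' e'0 H'] := bigon_sit S'.
  apply: (@drank_cst _ _ _ _ _ _ y).
  near=> q => cq; have q0 := cq 0; have q1 := cq 1.
  have tl : q 0 1 < 1 / 2 + e' / 2.
    by near: q; apply: near_coord_lt; rewrite t12; lra.
  have tg : 1 / 2 - e / 2 < q 0 1.
    by near: q; apply: near_coord_gt; rewrite t12; lra.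
  rewrite /on_cube2 /hcat_fun; case: ifPn => [t0|]; last rewrite -ltNge => t0.
    by have [||_ Hm _ _] := H (q 0 0) (2 * q 0 1); [lra|lra|apply: Hm; lra].
  by have [||Hm _ _ _] := H' (q 0 0) (2 * q 0 1 - 1);
    [lra|lra|apply: Hm; lra].
Unshelve. all: by end_near. Qed.

Lemma hcat_smooth x y z (g0 g1 : smooth_path x y) (g0' g1' : smooth_path y z)
    (S' : bigon g0' g1') (S : bigon g0 g1) :
  cube_smooth (on_cube2 (hcat_fun S' S)).
Proof.
by apply/cube_smoothP => p; apply: hcat_rank; exact/cube_smoothP/bigon_smooth.
Qed.

Lemma hcat_sit x y z (g0 g1 : smooth_path x y) (g0' g1' : smooth_path y z)
    (S' : bigon g0' g1') (S : bigon g0 g1) :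
  bigon_sitting x z (path_comp g0' g0) (path_comp g1' g1) (hcat_fun S' S).
Proof.
have [e e0 H] := bigon_sit S; have [e' e'0 H'] := bigon_sit S'.
exists (Num.min e e' / 2) => [|s t s01 t01].
  by case: (ltP e e') => ee'; lra.
have me : Num.min e e' <= e by rewrite ge_min lexx.
have me' : Num.min e e' <= e' by rewrite ge_min lexx orbT.
have m0 : 0 < Num.min e e' by case: (ltP e e') => ee'; lra.
rewrite /= /hcat_fun /cat_fun; case: ifPn => [t0|]; last rewrite -ltNge => t0.
  have [||Hx Hy H0 H1] := H s (2 * t); [by []|lra|].
  by split=> h; [apply: Hx|exfalso|apply: H0|apply: H1]; lra.
have [||Hx Hy H0 H1] := H' s (2 * t - 1); [by []|lra|].
by split=> h; [exfalso|apply: Hy|apply: H0|apply: H1]; lra.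
Qed.

(* Horizontal composition: concatenation in [t], first [S], then [S']. *)
Definition hcomp x y z (g0 g1 : smooth_path x y) (g0' g1' : smooth_path y z)
    (S' : bigon g0' g1') (S : bigon g0 g1) :
    bigon (path_comp g0' g0) (path_comp g1' g1) :=
  Bigon (hcat_smooth S' S) (hcat_sit S' S).

Lemma thin_path_refl x y (g : smooth_path x y) : thin_path g g.
Proof.
exists (bigon_id g) => p cp; apply: bigon_id_rank => // q.
exact/drank_path/path_smooth.
Qed.

Lemma thin_path_sym x y (g0 g1 : smooth_path x y) :
  thin_path g0 g1 -> thin_path g1 g0.
Proof. by move=> [S thS]; exists (srev S) => p; exact: srev_rank. Qed.

Lemma thin_path_trans x y (g0 g1 g2 : smooth_path x y) :
  thin_path g0 g1 -> thin_path g1 g2 -> thin_path g0 g2.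
Proof.
by move=> [S thS] [S' thS']; exists (vcomp S' S) => p; exact: vcat_rank.
Qed.

Lemma thin_path_inv x y (g0 g1 : smooth_path x y) :
  thin_path g0 g1 -> thin_path (path_inv g0) (path_inv g1).
Proof. by move=> [S thS]; exists (trev S) => p; exact: trev_rank. Qed.

Lemma thin_path_comp x y z (g0 g1 : smooth_path x y) (g0' g1' : smooth_path y z) :
  thin_path g0' g1' -> thin_path g0 g1 ->
  thin_path (path_comp g0' g0) (path_comp g1' g1).
Proof.
by move=> [S' thS'] [S thS]; exists (hcomp S' S) => p; exact: hcat_rank.
Qed.

Lemma p1_eqP x y (g0 g1 : smooth_path x y) : p1 g0 = p1 g1 <-> thin_path g0 g1.
Proof.
split=> [/(congr1 (@P1_class _ _ _ _ _))/= E|th].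
  by rewrite E; exact: thin_path_refl.
have E : thin_path g0 = thin_path g1.
  apply/funext => g; apply/propext; split; last exact: thin_path_trans.
  exact/thin_path_trans/thin_path_sym.
rewrite /p1; move: (ex_intro _ g0 _) (ex_intro _ g1 _) => /=.
by rewrite E => h h'; congr MkP1; exact: Prop_irrelevance.
Qed.

Lemma p1_surj x y (a : P1 x y) : exists g, p1 g = a.
Proof.
case: a => C [g E]; exists g; subst C; rewrite /p1.
by congr MkP1; exact: Prop_irrelevance.
Qed.

Definition P1_repr x y (a : P1 x y) : smooth_path x y := projT1 (cid (p1_surj a)).

Lemma P1_reprK x y (a : P1 x y) : p1 (P1_repr a) = a.
Proof. exact: projT2 (cid (p1_surj a)). Qed.

Definition P1_id x : P1 x x := p1 (path_id x).

Definition P1_comp x y z (b : P1 y z) (a : P1 x y) : P1 x z :=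
  p1 (path_comp (P1_repr b) (P1_repr a)).

Definition P1_inv x y (a : P1 x y) : P1 y x := p1 (path_inv (P1_repr a)).

Lemma P1_compE x y z (g' : smooth_path y z) (g : smooth_path x y) :
  P1_comp (p1 g') (p1 g) = p1 (path_comp g' g).
Proof. by apply/p1_eqP/thin_path_comp; apply/p1_eqP; rewrite P1_reprK. Qed.

Lemma P1_invE x y (g : smooth_path x y) : P1_inv (p1 g) = p1 (path_inv g).
Proof. by apply/p1_eqP/thin_path_inv/p1_eqP; rewrite P1_reprK. Qed.

End concatenation.

Local Open Scope group_scope.

(* The 2-morphisms [a => b] between the 1-morphisms [a b : G] of BEG: those
   labelled by the elements [h] of the crossed module with [t h * a = b], where
   [t = id]. *)
Record BE2 (G : groupType) (a b : G) := MkBE2 {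
  label : G;
  labelP : label = b * a^-1 }.

Lemma BE2_unique (G : groupType) (a b : G) (k k' : BE2 a b) : k = k'.
Proof.
by case: k k' => [h hP] [h' h'P]; subst h h'; congr MkBE2; exact: Prop_irrelevance.
Qed.

Section BEG.
Context {G : groupType}.
Implicit Types a b c : G.

Lemma BE_id_subproof a : 1 = a * a^-1.
Proof. by rewrite mulgV. Qed.

Definition BE_id a : BE2 a a := MkBE2 (BE_id_subproof a).

Lemma BE_vcomp_subproof a b c (k' : BE2 b c) (k : BE2 a b) :
  label k' * label k = c * a^-1.
Proof. by rewrite !labelP mulgA mulgVK. Qed.

Definition BE_vcomp a b c (k' : BE2 b c) (k : BE2 a b) : BE2 a c :=
  MkBE2 (BE_vcomp_subproof k' k).

(* The action [alpha] of the crossed module (G, G, id, alpha). *)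
Definition crossed_act a b : G := a * b * a^-1.

Lemma BE_hcomp_subproof a b a' b' (k' : BE2 a' b') (k : BE2 a b) :
  label k' * crossed_act a' (label k) = (b' * b) * (a' * a)^-1.
Proof. by rewrite !labelP /crossed_act invgM !mulgA mulgVK. Qed.

Definition BE_hcomp a b a' b' (k' : BE2 a' b') (k : BE2 a b) :
    BE2 (a' * a) (b' * b) :=
  MkBE2 (BE_hcomp_subproof k' k).

End BEG.

(* Functors from the path groupoid of [X] to BG. *)
Record path_functor (R : realType) (n : nat) (X : smoothManifoldType R n)
    (G : groupType) := PathFunctor {
  pf1 :> forall x y : X, P1 x y -> G;
  pf1_id : forall x, pf1 (P1_id x) = 1;
  pf1_comp : forall x y z (b : P1 y z) (a : P1 x y),
    pf1 (P1_comp b a) = pf1 b * pf1 a }.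

(* Strict 2-functors from the path 2-groupoid of [X] to BEG. Composable classes
   of bigons always have representatives with a common middle path. *)
Record path_2functor (R : realType) (n : nat) (X : smoothManifoldType R n)
    (G : groupType) := Path2Functor {
  pf_1 : path_functor X G;
  pf2 : forall (x y : X) (a b : P1 x y), B2 a b -> BE2 (pf_1 x y a) (pf_1 x y b);
  pf2_id : forall (x y : X) (g : smooth_path x y),
    pf2 (b2 (bigon_id g)) = BE_id (pf_1 x y (p1 g));
  pf2_vcomp : forall (x y : X) (g0 g1 g2 : smooth_path x y)
      (S' : bigon g1 g2) (S : bigon g0 g1),
    pf2 (b2 (vcomp S' S)) = BE_vcomp (pf2 (b2 S')) (pf2 (b2 S));
  (* the two sides live over provably but not definitionally equal
     1-morphisms, so their labels are compared *)
  pf2_hcomp : forall (x y z : X) (g0 g1 : smooth_path x y)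
      (g0' g1' : smooth_path y z) (S' : bigon g0' g1') (S : bigon g0 g1),
    label (pf2 (b2 (hcomp S' S))) =
    label (BE_hcomp (pf2 (b2 S')) (pf2 (b2 S))) }.

Definition is_derivative (R : realType) (n : nat) (X : smoothManifoldType R n)
    (G : groupType) (F : path_functor X G) (dF : path_2functor X G) : Prop :=
  forall (x y : X) (a : P1 x y), pf_1 dF x y a = F x y a.

Lemma derivative_exists (R : realType) (n : nat) (X : smoothManifoldType R n)
  (G : groupType) (F : path_functor X G) : exists dF, is_derivative F dF.
Proof.
pose d (x y : X) (a b : P1 x y) (_ : B2 a b) : BE2 (F x y a) (F x y b) :=
  MkBE2 erefl.
have d_id (x y : X) (g : smooth_path x y) :
    d _ _ _ _ (b2 (bigon_id g)) = BE_id (F x y (p1 g)) by exact: BE2_unique.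
have d_vcomp (x y : X) (g0 g1 g2 : smooth_path x y)
      (S' : bigon g1 g2) (S : bigon g0 g1) :
    d _ _ _ _ (b2 (vcomp S' S)) =
    BE_vcomp (d _ _ _ _ (b2 S')) (d _ _ _ _ (b2 S)) by exact: BE2_unique.
have d_hcomp (x y z : X) (g0 g1 : smooth_path x y)
      (g0' g1' : smooth_path y z) (S' : bigon g0' g1') (S : bigon g0 g1) :
    label (d _ _ _ _ (b2 (hcomp S' S))) =
    label (BE_hcomp (d _ _ _ _ (b2 S')) (d _ _ _ _ (b2 S))).
  by rewrite [RHS]labelP /= -!P1_compE !pf1_comp.
by exists (Path2Functor d_id d_vcomp d_hcomp).
Qed.

Lemma derivative_unique (R : realType) (n : nat) (X : smoothManifoldType R n)
    (G : groupType) (F : path_functor X G) (dF dF' : path_2functor X G)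
    (x y : X) (a b : P1 x y) (S : B2 a b) :
  is_derivative F dF -> is_derivative F dF' ->
  label (pf2 dF S) = label (pf2 dF' S).
Proof. by move=> h h'; rewrite !labelP !h !h'. Qed.

Definition boundary (R : realType) (n : nat) (X : smoothManifoldType R n)
    (x y : X) (a b : P1 x y) (S : B2 a b) : P1 y y :=
  P1_comp b (P1_inv a).

(* Main.v *)
Require Import Defs.
From HB Require Import structures.
From mathcomp Require Import all_boot all_order all_algebra.
From mathcomp Require Import all_classical all_reals all_analysis.
From mathcomp Require Import ring lra.

(** The 2-morphism [a => b] of the target is forced to carry the label
    [b * a^-1], so the label of a bigon [S : a => b] is [F b * (F a)^-1], while
    functoriality turns [F (boundary S)] into [F b * F a^-1]. The content of the
    theorem is therefore that a functor on the path groupoid preserves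
    inverses, that is, that inverse paths really are inverse in that groupoid:
    going along a path [g] and back is thin homotopic to the constant path
    (lemma [thin_backtrack]).

    The thin homotopy retracts the round trip to its starting point,
    [S s t = g ((1 - b s) * fold t)], where [fold] climbs from 0 to 1 and
    comes back and [b] is a smooth step from 0 to 1. It factors through the
    one-dimensional domain of [g], so its rank is at most 1 (lemma
    [drank_precomp]). The obvious choice of [fold], twice the distance of [t]
    to the ends of the unit interval, has a kink at [t = 1/2], where [S] may
    stop being smooth once [b s] is large enough. The kink can be smoothed because
    [g] is constant near its end: any change of [fold] above the level [1 - e]
    leaves [g \o fold] alone.

    All this rests on a smooth step function [R -> R], obtained from
    [exp (- 1 / x)], and on the stability of C^k maps under sums, products and
    composition. *)

Set Implicit Arguments.
Unset Strict Implicit.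
Unset Printing Implicit Defensive.

Import Order.TTheory GRing.Theory Num.Theory.
Import numFieldNormedType.Exports.

Local Open Scope classical_set_scope.
Local Open Scope ring_scope.

(** * Calculus of C^k maps *)

Section Ck_calculus.
Context {R : realType}.
Implicit Types V W : normedModType R.

(** Differentiability is local: [g - f] vanishes near [p], hence is
    differentiable there with zero differential. *)
Lemma near_eq_differentiable V W (f g : V -> W) p :
  (\forall q \near p, f q = g q) -> differentiable f p -> differentiable g p.
Proof.
move=> fg df; rewrite (_ : g = f + (g - f)); last by rewrite addrC subrK.
apply: differentiableD => //.
have e0 : (g - f) \o shift p = cst ((g - f) p) + (0 : V -> W) +o_ 0 id.
  apply/eqaddoP => _/posnumP[e].
  have : \forall q \near 0, f (q + p) = g (q + p).
    move: fg; rewrite (near_shift 0 p).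
    by apply: filterS => q; rewrite /= subr0.
  apply: filterS => q /= E; rewrite !fctE /= E (nbhs_singleton fg).
  by rewrite !subrr /= addr0 subr0 normr0 mulr_ge0.
have c0 : continuous ((\0 : {linear V -> W}) : V -> W) by exact: cst_continuous.
by apply/diff_locallyP; rewrite (@diff_unique _ _ _ _ \0).
Qed.

(** The formulas for the derivative of a sum, a product or a composite hold
    only on the set [U]; this lemma lets the inductions below use them there. *)
Lemma Ck_ext V W k (U : set V) (f g : V -> W) :
  open U -> (forall p, U p -> f p = g p) -> Ck k U f -> Ck k U g.
Proof.
move=> oU; elim: k f g => [|k IH] f g fg /=.
  move=> fc p Up; have fp : f @ p --> g p by rewrite -(fg p Up); exact: fc.
  apply: cvg_trans fp; apply: near_eq_cvg.
  by apply: filterS fg _; exact: open_nbhs_nbhs.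
move=> [fd fD].
have nfg p : U p -> \forall q \near p, f q = g q.
  by move=> Up; apply: filterS fg _; exact: open_nbhs_nbhs.
split=> [p Up|v]; first exact: near_eq_differentiable (nfg _ Up) (fd _ Up).
by apply: IH (fD v) => p /nfg; exact: near_eq_derive.
Qed.

Lemma Ck_le V W k (U : set V) (f : V -> W) : Ck k.+1 U f -> Ck k U f.
Proof.
elim: k f => [|k IH] f [fd fD].
  by move=> p /fd /differentiable_continuous.
by split=> // v; exact: IH (fD v).
Qed.

Lemma CkD V W k (U : set V) (f g : V -> W) :
  open U -> Ck k U f -> Ck k U g -> Ck k U (fun p => f p + g p).
Proof.
move=> oU; elim: k f g => [|k IH] f g /=.
  by move=> fc gc p Up; apply: continuousD; [exact: fc|exact: gc].
move=> [fd fD] [gd gD]; split=> [p Up|v].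
  by apply: differentiableD; [exact: fd|exact: gd].
apply: Ck_ext (IH _ _ (fD v) (gD v)) => // p Up; apply/esym.
by apply: deriveD; apply: diff_derivable; [exact: fd|exact: gd].
Qed.

(** The Leibniz rule for [a *: w] is the differential of a bilinear map, which
    requires scaling to be declared as one. *)
Lemma scale_is_bilinear W : bilinear_for
  (GRing.Scale.Law.clone _ _ *:%R _) (GRing.Scale.Law.clone _ _ *:%R _)
  (@GRing.scale R W).
Proof.
split=> [w|a] b u v /=; first by rewrite scalerDl scalerA.
by rewrite scalerDr !scalerA mulrC.
Qed.

HB.instance Definition _ W := bilinear_isBilinear.Build R R W W _ _
  (@GRing.scale R W) (@scale_is_bilinear W).

Lemma is_diff_scale V W (a : V -> R) (w : V -> W) p :
  differentiable a p -> differentiable w p ->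
  is_diff p (fun q => a q *: w q) (fun v => a p *: 'd w p v + 'd a p v *: w p).
Proof.
move=> da dw.
have sc : continuous (fun z : R * W => z.1 *: z.2) by exact: scale_continuous.
have ds := @differentiable_bilin _ _ _ _ (@GRing.scale R W) (a p, w p) sc.
have dp : differentiable (fun q => (a q, w q)) p by exact: differentiable_pair.
apply: DiffDef; first exact: (differentiable_comp dp ds).
rewrite (diff_comp dp ds) (diff_bilin _ sc) diff_pair //.
Qed.

Lemma Ck_scale V W k (U : set V) (a : V -> R) (w : V -> W) :
  open U -> Ck k U a -> Ck k U w -> Ck k U (fun p => a p *: w p).
Proof.
move=> oU; elim: k a w => [|k IH] a w.
  by move=> ac wc p Up; apply: continuousZ; [exact: ac|exact: wc].
move=> ak wk; have [ad aD] := ak; have [wd wD] := wk.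
have asd p : U p -> is_diff p (fun q => a q *: w q)
    (fun v => a p *: 'd w p v + 'd a p v *: w p).
  by move=> Up; apply: is_diff_scale; [exact: ad|exact: wd].
split=> [p /asd[] //|v].
have := CkD oU (IH _ _ (Ck_le ak) (wD v)) (IH _ _ (aD v) (Ck_le wk)).
apply: Ck_ext => // p Up; have [d dE] := asd _ Up.
rewrite [RHS](deriveE _ d) dE (deriveE _ (wd _ Up)).
by rewrite (deriveE _ (ad _ Up)).
Qed.

Lemma derive_line W (g : R -> W) (v x : R) :
  differentiable g x -> 'D_v g x = v *: 'D_1 g x.
Proof. by move=> dg; rewrite deriveE // diff1E // derive1E. Qed.

(** The chain rule [D_v (g \o a) = 'D_v a *: ('D_1 g \o a)] exhibits the derivative
    of the composite as a product of C^k maps. The middle space is the line: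
    the homotopies to come factor through the domain of a path. *)
Lemma Ck_comp V W k (U : set R) (U' : set V) (a : V -> R) (g : R -> W) :
  open U -> open U' -> (forall p, U' p -> U (a p)) ->
  Ck k U' a -> Ck k U g -> Ck k U' (fun p => g (a p)).
Proof.
move=> oU oU' aU; elim: k a g aU => [|k IH] a g aU.
  move=> ac gc p Up; apply: continuous_comp; first exact: ac.
  exact/gc/aU.
move=> ak gk; have [ad aD] := ak; have [gd gD] := gk.
split=> [p Up|v].
  by apply: differentiable_comp; [exact: ad|exact/gd/aU].
have := Ck_scale oU' (aD v) (IH _ _ aU (Ck_le ak) (gD 1)).
apply: Ck_ext => // p Up.
have da := ad _ Up; have dg := gd _ (aU _ Up).
rewrite [RHS](deriveE _ (differentiable_comp da dg)) diff_comp //=.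
by rewrite -!deriveE // [RHS]derive_line.
Qed.

Lemma Ck_id k : Ck k setT (id : R -> R).
Proof.
case: k => [|k]; first by move=> p _; exact: cvg_id.
split=> [p _|v]; first exact: ex_diff.
suff -> : 'D_v id = cst v :> (R -> R) by exact: Ck_cst.
by apply/funext => p; rewrite derive_id.
Qed.

Lemma CkM V k (U : set V) (f g : V -> R) :
  open U -> Ck k U f -> Ck k U g -> Ck k U (fun p => f p * g p).
Proof. exact: Ck_scale. Qed.

Lemma CkDc V k (U : set V) (c : R) (f : V -> R) :
  open U -> Ck k U f -> Ck k U (fun p => f p + c).
Proof. by move=> oU fk; apply: (CkD oU fk); exact: Ck_cst. Qed.

Lemma CkMc V k (U : set V) (c : R) (f : V -> R) :
  open U -> Ck k U f -> Ck k U (fun p => c * f p).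
Proof. by move=> oU; apply: (CkM oU); exact: Ck_cst. Qed.

Lemma Ck_coord l k (i : 'I_l) : Ck k setT (fun q : 'rV[R]_l => q 0 i).
Proof.
apply: (@Ck_affine R _ _ _ (fun q : 'rV[R]_l => q 0 i)
  (fun q : 'rV[R]_l => q 0 i) id k setT); last exact: Ck_id.
  by move=> p; exact: differentiable_coord.
by move=> h v p; rewrite !mxE.
Qed.

Lemma Ck_reparam l k (a c : R) (f : R -> R) (i : 'I_l) :
  Ck k setT f -> Ck k setT (fun q : 'rV[R]_l => f (a * q 0 i + c)).
Proof.
move=> fk; apply: (@Ck_comp _ _ k setT setT
  (fun q : 'rV[R]_l => a * q 0 i + c) f openT openT) => //.
by apply: (CkDc _ openT); apply: (CkMc _ openT); exact: Ck_coord.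
Qed.

End Ck_calculus.

(** * A smooth step function *)

Section smooth_step.
Context {R : realType}.

(** The powers of [1 / x] are there for induction on the order of
    differentiation: the span of the family is closed under derivatives
    ([flat_is_derive]), so all its members are smooth together. *)
Definition flat (j : nat) (x : R) : R :=
  if 0 < x then x^-1 ^+ j * expR (- x^-1) else 0.

Lemma flat_le0 j x : x <= 0 -> flat j x = 0.
Proof. by rewrite /flat leNgt => /negbTE ->. Qed.

Lemma flat_ge0 j x : 0 <= flat j x.
Proof.
rewrite /flat; case: ifPn => // x0.
by rewrite mulr_ge0 ?expR_ge0 // exprn_ge0 // invr_ge0 ltW.
Qed.

Lemma flatS j x : x^-1 * flat j x = flat j.+1 x.
Proof. by rewrite /flat; case: ifP => _; rewrite ?mulr0 // mulrA exprS. Qed.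

(** With [u = 1 / x] this is [u ^ (j + 1) / (j + 1)! <= exp u], one term of the
    exponential series; applied to [flat j.+1] it controls the difference
    quotient of [flat j] at 0. *)
Lemma flat_le j x : flat j x <= j.+1`!%:R * `|x|.
Proof.
have [x0|x0] := leP x 0; first by rewrite flat_le0.
have u0 : 0 < x^-1 by rewrite invr_gt0.
have ltf : 0 < j.+1`!%:R :> R by rewrite ltr0n fact_gt0.
rewrite /flat x0 gtr0_norm // expRN ler_pdivrMr ?expR_gt0 //.
have := expR_ge1Dxn j (ltW u0); set E := expR _ => lE.
have {}lE : x^-1 ^+ j.+1 <= j.+1`!%:R * E.
  by rewrite mulrC -ler_pdivrMr //; apply: le_trans lE; rewrite lerDr.
by rewrite mulrAC -ler_pdivrMr // mulrC -exprS.
Qed.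

Lemma flat_is_derive j (x : R) :
  is_derive x 1 (flat j) (flat j.+2 x - j%:R * flat j.+1 x).
Proof.
have [x0|x0|->] := ltgtP x 0.
- rewrite !flat_le0 ?ltW // mulr0 subr0.
  apply: (@near_eq_is_derive _ _ _ (cst 0)).
  near=> y; rewrite flat_le0 // ltW //.
  by near: y; exact: (lt_nbhsl x0).
- pose h := fun y : R => y^-1 ^+ j * expR (- y^-1).
  apply: (@near_eq_is_derive _ _ _ h).
    near=> y; rewrite /flat ifT //.
    by near: y; exact: (lt_nbhsr x0).
  pose u := fun y : R => y^-1.
  have xn0 : x != 0 by rewrite gt_eqF.
  have du : is_derive x 1 u (- (x^-1 ^+ 2)).
    apply: DeriveDef; first exact: (@derivableV _ _ id).
    by rewrite (@deriveV _ _ id) // derive_id exprVn /GRing.scale /= mulr1.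
  have -> : h = u ^+ j * (expR \o (- u)).
    by rewrite /h /u funeqE => y; rewrite exprfctE.
  apply: is_derive_eq.
  rewrite !exprfctE /flat x0 /u /GRing.scale /= !exprS.
  case: j {h} => [|j] /=; rewrite ?exprS; ring.
- rewrite !flat_le0 // mulr0 subr0.
  have q0 : (fun h : R => h^-1 *: (flat j (h *: 1 + 0) - flat j 0)) @ 0^'
      --> (0 : R).
    apply/cvgr0Pnorm_le => e e0; near=> h.
    rewrite (flat_le0 _ (lexx 0)) subr0 addr0 /GRing.scale /= mulr1 flatS.
    rewrite ger0_norm ?flat_ge0 //; apply: le_trans (flat_le _ _) _.
    have f0 : 0 < (j.+2)`!%:R :> R by rewrite ltr0n fact_gt0.
    rewrite -ler_pdivlMl //.
    near: h; apply: dnbhs0_le.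
    by rewrite mulr_gt0 ?invr_gt0.
  apply: DeriveDef.
    by apply/cvg_ex; exists 0.
  exact/cvg_lim.
Unshelve. all: by end_near. Qed.

Lemma flat_Ck k j : Ck k setT (flat j).
Proof.
have dflat j' x : differentiable (flat j') x.
  by apply/derivable1_diffP; case: (flat_is_derive j' x).
elim: k j => [|k IH] j.
  by move=> p _; exact: differentiable_continuous.
split=> [p _|v]; first exact: dflat.
have := CkD openT (Ck_scale openT (Ck_cst v k setT) (IH j.+2))
  (Ck_scale openT (Ck_cst (- (v * j%:R)) k setT) (IH j.+1)).
apply: Ck_ext; first exact: openT.
move=> p _; rewrite derive_line //; have [_ ->] := flat_is_derive j p.
by rewrite /GRing.scale /= mulrBr mulrA mulNr.
Qed.

Lemma flat_homo : {homo flat 0 : x y / x <= y}.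
Proof.
move=> x y xy; have [x0|x0] := leP x 0; first by rewrite flat_le0 ?flat_ge0.
have y0 := lt_le_trans x0 xy.
by rewrite /flat x0 y0 !mul1r ler_expR lerN2 lef_pV2.
Qed.

Lemma flat_gt0 j x : 0 < x -> 0 < flat j x.
Proof.
by move=> x0; rewrite /flat x0 mulr_gt0 ?expR_gt0 // exprn_gt0 ?invr_gt0.
Qed.

(** Applying [flat 0] twice avoids dividing by a function: [flat 0 (c - flat 0 x)]
    is at its maximum [C] for [x <= 0], and vanishes once [flat 0 x] reaches
    [c = flat 0 1]. *)
Lemma smooth_step_exists : exists b : R -> R,
  [/\ Cinfty setT b, forall x, 0 <= b x <= 1,
      forall x, x <= 0 -> b x = 0 & forall x, 1 <= x -> b x = 1].
Proof.
pose c := flat 0 1; have c0 : 0 < c by exact: flat_gt0.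
pose C := flat 0 c; have C0 : 0 < C by exact: flat_gt0.
exists (fun x => 1 + - C^-1 *: flat 0 (c + (-1) *: flat 0 x)); split.
- move=> k; apply: CkD; [exact: openT|exact: Ck_cst|].
  apply: Ck_scale; [exact: openT|exact: Ck_cst|].
  apply: (Ck_comp openT openT); [by []| |exact: flat_Ck].
  apply: CkD; [exact: openT|exact: Ck_cst|].
  by apply: Ck_scale; [exact: openT|exact: Ck_cst|exact: flat_Ck].
- move=> x; rewrite scaleNr scaleN1r /GRing.scale /= mulrC -/C.
  have H : flat 0 (c - flat 0 x) <= C.
    by apply: flat_homo; rewrite gerBl flat_ge0.
  have H0 : 0 <= flat 0 (c - flat 0 x) / C by rewrite divr_ge0 ?flat_ge0 // ltW.
  have : flat 0 (c - flat 0 x) / C <= 1 by rewrite ler_pdivrMr // mul1r.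
  by lra.
- move=> x x0; rewrite (flat_le0 _ x0) scaler0 addr0 -/C /GRing.scale /=.
  by rewrite mulNr mulVf ?subrr // gt_eqF.
- move=> x x1; rewrite [flat 0 (_ + _)]flat_le0 ?scaler0 ?addr0 //.
  by rewrite scaleN1r subr_le0; exact: flat_homo.
Qed.

End smooth_step.

(** * Going along a path and back *)

Section backtracking.
Context {R : realType}.

(** The differential of a map factoring through a path has its image in the line
    spanned by the velocity of the path. *)
Lemma drank_precomp n (X : smoothManifoldType R n) l (f : R -> X)
    (a : 'rV[R]_l -> R) p :
  cube_smooth (on_cube1 f) -> Cinfty setT a ->
  (forall q, cube q -> 0 <= a q <= 1) -> cube p ->
  drank_le (fun q => f (a q)) p 1.
Proof.
move=> fs asm a01 cp.
pose A (u : R) : 'rV[R]_1 := u *: const_mx 1.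
have AE u : A u 0 0 = u by rewrite !mxE mulr1.
have dA u : differentiable A u.
  by apply: (@differentiableZl _ _ _ id); exact: ex_diff.
have cA q : cube q -> cube (A (a q)).
  by move=> cq i; rewrite ord1 AE; exact: a01.
have [c [g [ac [U [oU Up Uf gs]]]]] := fs _ (cA _ cp).
have oA : open (A @^-1` U).
  by apply: open_comp => // u _; exact: differentiable_continuous.
have a0 q : {for q, continuous a} := asm 0 q I.
have oV : open (a @^-1` (A @^-1` U)) by apply: open_comp => // q _; exact: a0.
have ga k : Ck k (A @^-1` U) (g \o A).
  apply: (@Ck_affine R _ _ _ A A) (gs k) => // h u v.
  by rewrite /A scalerDl scalerA.
have gak k : Ck k (a @^-1` (A @^-1` U)) (fun q => (g \o A) (a q)).
  by apply: (Ck_comp oA oV) (ga k) => //; exact: Ck_subset (asm k).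
exists c, (fun q => (g \o A) (a q)); split.
  split=> //; exists (a @^-1` (A @^-1` U)); split=> // q Uq cq.
  by have := Uf _ Uq (cA _ cq); rewrite /on_cube1 AE.
have dg := (ga 1).1 _ Up; have da := (asm 1).1 p I.
apply: leq_trans (rank_leq_row ('D_1 (g \o A) (a p))).
apply/mxrankS/rV_subP => v /submxP[w ->].
rewrite -deriveEjacobian; last exact: (differentiable_comp da dg).
rewrite (deriveE _ (differentiable_comp da dg)) diff_comp //=.
by rewrite -!deriveE // derive_line // scalemx_sub.
Qed.

(** A smooth substitute for [min u 1]: a convex combination of [u] and 1, the
    weight passing from the former to the latter as [u] goes from
    [1 - e] to 1. *)
Lemma clamp_exists (e : R) : 0 < e -> exists theta : R -> R,
  [/\ Cinfty setT theta, forall u, u <= 1 -> u <= theta u <= 1,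
      forall u, u <= 1 - e -> theta u = u & forall u, 1 <= u -> theta u = 1].
Proof.
move=> e0; have [b [bs b01 b0 b1]] := @smooth_step_exists R.
have en0 : e != 0 by rewrite gt_eqF.
exists (fun u => u + b (e^-1 * u + (1 - e^-1)) * (-1 * u + 1)).
have bE u : e^-1 * u + (1 - e^-1) = (u - (1 - e)) / e by field.
split=> [k|u u1|u ue|u u1]; rewrite ?bE.
- apply: (CkD openT (Ck_id k)); apply: (CkM openT).
    apply: (@Ck_comp R _ _ k setT setT _ b openT openT) => //.
    by apply: (CkDc _ openT); apply: (CkMc _ openT); exact: Ck_id.
  by apply: (CkDc _ openT); apply: (CkMc _ openT); exact: Ck_id.
- by have /andP[] := b01 ((u - (1 - e)) / e); nra.
- by rewrite b0 ?mul0r ?addr0 // pmulr_lle0 ?invr_gt0 // subr_le0.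
- by rewrite b1; [ring|rewrite ler_pdivlMr //; lra].
Qed.

Context {n : nat} {X : smoothManifoldType R n}.

(** In the proof, [e] is a sitting parameter of [g] and [th] a smooth clamp at
    1 that changes only values above [1 - e], where [g] is constant. *)
Lemma thin_backtrack (x y : X) (g : smooth_path x y) :
  thin_path (path_comp (path_inv g) g) (path_id x).
Proof.
have [e e0 H] := path_sit g.
have [b [bs b01 b0 b1]] := @smooth_step_exists R.
have [|th [ths th01 thu th1]] := @clamp_exists e; first by lra.
(* On each half of [0, 1] one of the two clamped terms is 1, so that [fold t] is
   [th (2 * t)] on the first half and [th (2 - 2 * t)] on the second; as a sum
   it is smooth at [t = 1/2] as well. *)
pose fold (t : R) := th (2 * t + 0) + (th (-2 * t + 2) + -1).
(* The affine change of variable puts the transition of [b] on [1/4, 3/4], so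
   that the homotopy is stationary near both ends of [0, 1]. *)
pose shrink (s : R) := -1 * b (2 * s + - (1 / 2)) + 1.
pose a (q : 'rV[R]_2) := shrink (q 0 0) * fold (q 0 1).
have asm : Cinfty setT a.
  move=> k; apply: (CkM openT).
    by apply: (CkDc _ openT); apply: (CkMc _ openT); exact: Ck_reparam (bs k).
  apply: (CkD openT); first exact: Ck_reparam (ths k).
  by apply: (CkDc _ openT); exact: Ck_reparam (ths k).
have foldl (t : R) : t <= 1 / 2 -> fold t = th (2 * t).
  by move=> t12; rewrite /fold addr0 (th1 (-2 * t + 2)); lra.
have foldr (t : R) : 1 / 2 <= t -> fold t = th (2 - 2 * t).
  move=> t12; rewrite /fold addr0 th1; last by lra.
  by rewrite (_ : -2 * t + 2 = 2 - 2 * t); lra.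
have th_01 (u : R) : 0 <= u <= 1 -> 0 <= th u <= 1.
  by move=> /andP[u0 /th01 /andP[uth ->]]; rewrite (le_trans u0).
have fold01 (t : R) : 0 <= t <= 1 -> 0 <= fold t <= 1.
  move=> t01; have [t12|/ltW t12] := leP t (1 / 2).
    by rewrite foldl //; apply: th_01; lra.
  by rewrite foldr //; apply: th_01; lra.
have shrink01 (s : R) : 0 <= shrink s <= 1.
  by rewrite /shrink; have := b01 (2 * s + - (1 / 2)); lra.
have a01 (s t : R) : 0 <= t <= 1 -> 0 <= shrink s * fold t <= 1.
  by move=> /fold01 /andP[f0 f1]; have /andP[s0 s1] := shrink01 s; nra.
have aq01 q : cube q -> 0 <= a q <= 1 by move=> cq; apply: a01; exact: (cq 1).
pose S (s t : R) := g (shrink s * fold t).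
have Sr p : cube p -> drank_le (on_cube2 S) p 1.
  exact: drank_precomp (path_smooth g) asm aq01.
have Ss : cube_smooth (on_cube2 S).
  by move=> p /Sr[c [h [ch _]]]; exists c, h.
have gx (u : R) : 0 <= u <= 1 -> u < e -> g u = x by move=> /H[].
have gy (u : R) : 0 <= u <= 1 -> 1 - e < u -> g u = y by move=> /H[].
have gth (u : R) : 0 <= u <= 1 -> g (th u) = g u.
  move=> u01; have [ue|ue] := leP u (1 - e); first by rewrite thu.
  have /andP[_ /th01 /andP[uth _]] := u01.
  by rewrite !gy //; [exact: th_01|exact: lt_le_trans uth].
have small (s t : R) : 0 <= t <= 1 -> fold t < e -> S s t = x.
  move=> t01 ft; apply: gx; first exact: a01.
  by have /andP[? ?] := fold01 _ t01; have /andP[? ?] := shrink01 s; nra.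
have Ssit : bigon_sitting x x (path_comp (path_inv g) g) (path_id x) S.
  exists (e / 4) => [|s t s01 t01]; first by lra.
  split=> h.
  - by apply: small => //; rewrite foldl ?thu; lra.
  - by apply: small => //; rewrite foldr ?thu; lra.
  - rewrite /S /shrink b0; last by lra.
    rewrite mulr0 add0r mul1r /= /cat_fun /inv_fun.
    case: ifPn => [t12|]; last rewrite -ltNge => t12.
      by rewrite foldl // gth //; lra.
    by rewrite foldr ?(ltW t12) // gth; [congr path_fun|]; lra.
  - rewrite /S /shrink b1; last by lra.
    by rewrite mulr1 addNr mul0r gx //; lra.
by exists (Bigon Ss Ssit).
Qed.

End backtracking.

Local Open Scope group_scope.

Lemma path_functor_inv (R : realType) (n : nat) (X : smoothManifoldType R n)
    (G : groupType) (F : path_functor X G) (x y : X) (a : P1 x y) :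
  F y x (P1_inv a) = (F x y a)^-1.
Proof.
have [g <-] := p1_surj a.
apply: (mulIg (F x y (p1 g))); rewrite mulVg -pf1_comp P1_invE P1_compE.
by rewrite -(pf1_id F x); congr (F x x); exact/p1_eqP/thin_backtrack.
Qed.

Theorem theorem3p4 (R : realType) (m n : nat) (X : smoothManifoldType R m)
    (G : lieGroupType R n) (F : path_functor X G) (dF : path_2functor X G)
    (dF_derivative : is_derivative F dF)
    (x y : X) (a b : P1 x y) (S : B2 a b) :
  label (pf2 dF S) = F y y (boundary S).
Proof.
by rewrite labelP !dF_derivative pf1_comp path_functor_inv.
Qed.
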